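(* Let $(\mathcal X,\rho)$ be a non-empty Polish metric space with Borel $\sigma$-field $\mathfrak B(\mathcal X)$, and let $\mathcal Y\in\mathfrak B(\mathcal X)$ satisfy the entropy condition $$c_{x,0}\,s^{-\gamma}\le \log \mathcal N_{\mathcal X}(s,\mathcal Y,\rho)\le c_{x,1}\,s^{-\gamma}\qquad\text{for all } s\in(0,s_0),$$ for some constants $s_0>0$, $0<c_{x,0}<c_{x,1}$, $\gamma>0$. Fix $C>0$ and $\beta\in(0,1]$, and let $\mathcal G=\mathcal G_{\beta,C}$ be the class of all Borel measurable $g:\mathcal X\to\mathbb R$ with $\sup_{y\in\mathcal Y}|g(y)|\le C$ and $|g(y)-g(z)|\le C\rho(y,z)^\beta$ for all $y,z\in\mathcal Y$. For each $n$, observe $(X_1,Y_1),\dots,(X_n,Y_n)$ with $Y_j=g(X_j)+\varepsilon_j$, where $g\in\mathcal G$, the pairs $(X_1,\varepsilon_1),\dots,(X_n,\varepsilon_n)$ are i.i.d., the $X_j$ take values in $\mathcal X$ with law $P_{X,n}$ on $\mathfrak B(\mathcal X)$ satisfying $P_{X,n}(\mathcal Y)=1$, the $\varepsilon_j$ are real-valued, and $E(\varepsilon_1\mid X_1)=0$ and $\operatorname{var}(\varepsilon_1\mid X_1)\le c_v$ almost surely, for a constant $c_v$. Define, with $K=1_{[0,1)}$ and $K_h:=K(\cdot/h)$, $$\hat A(x)=\frac1n\sum_{j=1}^n Y_jK_h(\rho(x,X_j)),\quad \hat B(x)=\frac1n\sum_{j=1}^n K_h(\rho(x,X_j)),\quad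 \hat g(x)=\begin{cases}\hat A(x)/\hat B(x),&\hat B(x)>\delta_n,\\ 0,&\text{otherwise},\end{cases}$$ where $\delta_n=n^{-\eta}$ with $\eta\in(0,1/2)$ and $h=\{d\log n\}^{-1/\gamma}$ with $d\in(0,\eta\, c_{x,1}^{-1}4^{-\gamma})$. Then for any sequence $\{P_{X,n}\}_n$ of such design measures, $$\sup_{g\in\mathcal G}\int E|\hat g(x)-g(x)|^2\,\mathrm dP_{X,n}(x)=\mathcal O\big(\{\log n\}^{-2\beta/\gamma}\big)\quad (n\to\infty).$$
   Context: $\mathcal N_{\mathcal X}(\delta,\mathcal Y,\rho)$ denotes the covering number: the minimal number of open $\rho$-balls in $\mathcal X$ of radius $\delta$ whose union contains $\mathcal Y$. A Polish metric space is a separable complete metric space. The expectation $E$ is over the data $(X_j,Y_j)_{j\le n}$ for fixed $x$. *)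

(* Defs.v *)
From HB Require Import structures.
From mathcomp Require Import all_boot all_order all_algebra.
From mathcomp Require Import all_classical all_reals all_analysis.
Unset Printing Implicit Defensive.
Import Order.TTheory GRing.Theory Num.Theory.
Import numFieldNormedType.Exports.
Local Open Scope classical_set_scope.
Local Open Scope ring_scope.

(* non-empty metric spaces: metric structure together with a distinguished point *)
#[short(type="pmetricType")]
HB.structure Definition PointedMetric (K : numDomainType) :=
  { M of Metric K M & isPointed M }.

Notation borel T := (g_sigma_algebraType (@open T)).

Section Defs.
Context {R : realType} {T : pmetricType R}.

Definition polish : Prop :=
  (exists D : set T, countable D /\ dense D) /\
  (forall F : set_system T, ProperFilter F -> cauchy F -> exists x : T, F --> x).


Definition is_cover (Y : set T) (delta : R) (k : nat) : Prop :=
  exists c : 'I_k -> T, forall y, Y y -> exists i : 'I_k, mdist (c i) y < delta.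

Definition is_covering_number (Y : set T) (delta : R) (N : nat) : Prop :=
  is_cover Y delta N /\ forall k, is_cover Y delta k -> (N <= k)%N.

Definition entropy_condition (Y : set T) (s0 c0 c1 gam : R) : Prop :=
  forall s, 0 < s < s0 -> exists N : nat, is_covering_number Y s N /\
    c0 * s `^ (- gam) <= ln N%:R <= c1 * s `^ (- gam).

Definition holder_class (Y : set T) (beta C : R) : set (borel T -> R) :=
  [set g : borel T -> R | measurable_fun [set: borel T] g /\
           (forall y, Y y -> `|g y| <= C) /\
           (forall y z, Y y -> Y z -> `|g y - g z| <= C * (mdist y z) `^ beta)].

Definition Kbox (u : R) : R := if (0 <= u) && (u < 1) then 1 else 0.

Definition estA (n : nat) (h : R) (Xs : 'I_n -> T) (Ys : 'I_n -> R) (x : T) : R :=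
  n%:R^-1 * \sum_(j < n) Ys j * Kbox (mdist x (Xs j) / h).
Definition estB (n : nat) (h : R) (Xs : 'I_n -> T) (x : T) : R :=
  n%:R^-1 * \sum_(j < n) Kbox (mdist x (Xs j) / h).
Definition ghat (n : nat) (h deltan : R) (Xs : 'I_n -> T) (Ys : 'I_n -> R)
  (x : T) : R :=
  if estB n h Xs x > deltan then estA n h Xs Ys x / estB n h Xs x else 0.

End Defs.

Section Prob.
Context {R : realType} {T : pmetricType R}.
Context {d : measure_display} {Om : measurableType d}.
Local Open Scope ereal_scope.

Definition iid_pairs (P : probability Om R) (n : nat)
  (Z : 'I_n -> Om -> (borel T * R)%type) : Prop :=
  (forall A : 'I_n -> set (borel T * R)%type, (forall j, measurable (A j)) ->
     P (\bigcap_(j in [set: 'I_n]) (Z j @^-1` A j)) = \prod_(j < n) P (Z j @^-1` A j))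
  /\ (forall (j k : 'I_n) (A : set (borel T * R)%type), measurable A ->
        P (Z j @^-1` A) = P (Z k @^-1` A)).

(* E(eps | X) = 0 a.s. (defining property of the conditional expectation) *)
Definition cond_mean_zero (P : probability Om R) (X : Om -> borel T)
  (eps : Om -> R) : Prop :=
  P.-integrable setT (EFin \o eps) /\
  forall B : set (borel T), measurable B ->
    \int[P]_(w in X @^-1` B) (eps w)%:E = 0.

(* var(eps | X) = E(eps^2 | X) <= cv a.s. (given E(eps|X) = 0) *)
Definition cond_var_le (P : probability Om R) (X : Om -> borel T)
  (eps : Om -> R) (cv : R) : Prop :=
  forall B : set (borel T), measurable B ->
    \int[P]_(w in X @^-1` B) ((eps w) ^+ 2)%:E <= cv%:E * P (X @^-1` B).

Definition risk (P : probability Om R) (PX : probability (borel T) R)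
  (n : nat) (h deltan : R) (X : 'I_n -> Om -> borel T) (eps : 'I_n -> Om -> R)
  (g : borel T -> R) : \bar R :=
  \int[PX]_x \int[P]_w
     (((ghat n h deltan (fun j => X j w) (fun j => g (X j w) + eps j w) x
        - g x) ^+ 2)%R)%:E.

End Prob.

(* Main.v *)
(* For [x] in [Y] the squared error is at most
   [2 C^2 h^(2 beta) + 2 (W / delta_n)^2 + C^2 1{estB x <= delta_n}], where the
   noise [W = n^-1 sum_j eps_j K_h(rho(x, X_j))] is a sum of uncorrelated terms,
   so that [E W^2 <= cv / n].  For the last term, cover [Y]
   by [N] balls [S_i] of radius [h / 2]: if [x] lies in [S_i], the ball of radius
   [h] around [x] contains [S_i], so [estB x <= delta_n] forces the empirical mass
   of [S_i] to be at most [delta_n], and by Chebyshev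
   [PX S_i * P(empirical mass of S_i <= delta_n) <= 8 / n + 2 delta_n].
   Summing over [i] costs a factor [N <= n^k] with [k < eta], by the choice of [d].
   Hence every term but the bias [h^(2 beta)] is polynomially small in [n]. *)
Require Import Defs.
From HB Require Import structures.
From mathcomp Require Import all_boot all_order all_algebra.
From mathcomp Require Import all_classical all_reals all_analysis.
From mathcomp Require Import measurable_realfun ring lra.
Import Order.TTheory GRing.Theory Num.Theory.
Local Open Scope classical_set_scope.
Local Open Scope ring_scope.

(** * Independence, second moments and a lower-tail bound *)

Section Integration.
Set Implicit Arguments. Unset Strict Implicit.
Context {d : measure_display} {Om : measurableType d} {R : realType}.
Local Open Scope ereal_scope.
Import HBNNSimple.

(* The left-hand side need not be measurable: its integral is a supremum over
   simple functions below it, and those are measurable. *)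
Lemma le_integral_nonmeas (mu : {measure set Om -> \bar R}) (f g : Om -> \bar R) :
  (forall x, 0 <= f x) -> (forall x, 0 <= g x) -> measurable_fun setT g ->
  {ae mu, forall x, f x <= g x} -> \int[mu]_x f x <= \int[mu]_x g x.
Proof.
move=> f0 g0 mg fg; rewrite ge0_integralTE//.
apply: ge_ereal_sup => /= _ [h hf <-].
rewrite -integralT_nnsfun; apply: ae_ge0_le_integral => //.
- by move=> x _; rewrite lee_fin; exact: fun_ge0.
- by apply/measurable_EFinP; exact: measurable_funP.
- by apply: filterS fg => x fgx _; exact: (le_trans (hf x)).
Qed.

(** The joint law of [U] and [V] agrees with the product of the marginal laws on rectangles, hence
    everywhere; Fubini then separates the integral of [z.1 * z.2]. *)
Lemma indep_integralM (P : probability Om R) (U V : Om -> R) :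
  measurable_fun setT U -> measurable_fun setT V ->
  P.-integrable setT (EFin \o U) -> P.-integrable setT (EFin \o V) ->
  P.-integrable setT (EFin \o (U \* V)%R) ->
  (forall A B : set R, measurable A -> measurable B ->
     P (U @^-1` A `&` V @^-1` B) = P (U @^-1` A) * P (V @^-1` B)) ->
  \int[P]_w (U w * V w)%:E = \int[P]_w (U w)%:E * \int[P]_w (V w)%:E.
Proof.
move=> mU mV iU iV iUV indep.
pose U' : {mfun Om >-> R} := HB.pack U (isMeasurableFun.Build _ _ _ _ _ mU).
pose V' : {mfun Om >-> R} := HB.pack V (isMeasurableFun.Build _ _ _ _ _ mV).
have mUV : measurable_fun setT (fun w => (U w, V w)) by exact: measurable_fun_pair.
pose UV : {mfun Om >-> (R * R)%type} :=
  HB.pack (fun w => (U w, V w)) (isMeasurableFun.Build _ _ _ _ _ mUV).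
pose mu1 := distribution P U'; pose mu2 := distribution P V'.
pose mu := distribution P UV.
pose f (z : R * R) : \bar R := (z.1 * z.2)%:E.
have mf : measurable_fun setT f.
  by apply/measurable_EFinP; exact: measurable_funM.
have muE A : measurable A -> (mu1 \x mu2) A = mu A.
  apply: product_measure_unique => B D mB mD.
  by rewrite /mu1 /mu2 /mu /= /distribution /pushforward -indep.
have -> : \int[P]_w (U w * V w)%:E = \int[mu]_z f z.
  by rewrite /mu /distribution integral_pushforward.
have imu : (mu1 \x mu2).-integrable setT f.
  apply/integrableP; split => //.
  rewrite (eq_measure_integral mu) => [|A mA _]; last exact: muE.
  have : mu.-integrable setT f by apply: integrable_pushforward.
  by move=> /integrableP[].
rewrite (eq_measure_integral (mu1 \x mu2)) => [|A mA _]; last exact: esym (muE _ mA).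
rewrite -integral12_prod_meas1//.
have i1 : mu1.-integrable setT EFin by apply: integrable_pushforward.
have i2 : mu2.-integrable setT EFin by apply: integrable_pushforward.
have E1 : \int[mu1]_u u%:E = \int[P]_w (U w)%:E by rewrite /mu1 integral_pushforward.
have E2 : \int[mu2]_u u%:E = \int[P]_w (V w)%:E by rewrite /mu2 integral_pushforward.
rewrite -E1 -E2.
have F2 : \int[mu2]_v v%:E \is a fin_num by apply: integrable_fin_num.
rewrite -(fineK F2) -integralZr//.
by apply: eq_integral => u _; rewrite fineK// -integralZl.
Qed.

Lemma sqr_integrable (P : probability Om R) (W : Om -> R) (v : R) :
  measurable_fun setT W -> \int[P]_w (W w ^+ 2)%:E <= v%:E ->
  P.-integrable setT (fun w => (W w ^+ 2)%:E).
Proof.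
move=> mW Wv; apply/integrableP; split.
  by apply/measurable_EFinP; exact: measurable_funX.
apply: le_lt_trans (ltry v); apply: le_trans Wv.
under eq_integral do rewrite /= ger0_norm ?sqr_ge0//.
by [].
Qed.

Lemma integrable_prod_sqr (P : probability Om R) (U V : Om -> R) :
  measurable_fun setT U -> measurable_fun setT V ->
  P.-integrable setT (fun w => (U w ^+ 2)%:E) ->
  P.-integrable setT (fun w => (V w ^+ 2)%:E) ->
  P.-integrable setT (EFin \o (U \* V)%R).
Proof.
move=> mU mV iU iV; have := integrableD measurableT iU iV.
apply: le_integrable => //.
  by apply/measurable_EFinP; exact: measurable_funM.
move=> x _ /=; rewrite lee_fin normrM [leRHS]ger0_norm ?addr_ge0 ?sqr_ge0//.
rewrite -(real_normK (num_real (U x))) -(real_normK (num_real (V x))).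
have := sqr_ge0 (`|U x| - `|V x|); nra.
Qed.

(** Only covariances enter the second-moment arguments, so two indices suffice. The arbitrary space
    [S] lets the property pass from the pairs [(X j, eps j)] to functions of them. *)
Definition pairwise_indep {d' : measure_display} {S : measurableType d'}
    (P : probability Om R) n (Z : 'I_n -> Om -> S) : Prop :=
  forall j k, j != k -> forall A B : set S, measurable A -> measurable B ->
    P (Z j @^-1` A `&` Z k @^-1` B) = P (Z j @^-1` A) * P (Z k @^-1` B).

Lemma pairwise_indep_comp {d1 d2 : measure_display}
    {S1 : measurableType d1} {S2 : measurableType d2}
    (P : probability Om R) n (Z : 'I_n -> Om -> S1) (F : S1 -> S2) :
  measurable_fun setT F -> pairwise_indep P Z ->
  pairwise_indep P (fun j => F \o Z j).
Proof.
move=> mF indep j k jk A B mA mB.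
apply: (indep j k jk (F @^-1` A) (F @^-1` B));
  by rewrite -[_ @^-1` _]setTI; exact: mF.
Qed.

(** Expanding the square, each diagonal term contributes at most [v], while the others factor by
    independence and vanish because the means are zero. *)
Lemma second_moment_sum (P : probability Om R) n (W : 'I_n -> Om -> R) (v : R) :
  (forall j, measurable_fun setT (W j)) ->
  (forall j, \int[P]_w (W j w ^+ 2)%:E <= v%:E) ->
  (forall j, \int[P]_w (W j w)%:E = 0) ->
  pairwise_indep P W ->
  \int[P]_w ((\sum_(j < n) W j w) ^+ 2)%:E <= (n%:R * v)%:E.
Proof.
move=> mW Wv W0 indep.
have iW2 j := sqr_integrable (mW j) (Wv j).
have iWW j k : P.-integrable setT (EFin \o (W j \* W k)%R).
  exact: integrable_prod_sqr.
have iW j : P.-integrable setT (EFin \o W j).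
  (* Pairing [W j] with the constant 1 deduces integrability from square integrability. *)
  have m1 : measurable_fun [set: Om] (cst 1%R : Om -> R) by [].
  have i1 : P.-integrable setT (fun w : Om => ((cst 1%R w : R) ^+ 2)%:E).
    exact: (@finite_measure_integrable_cst _ _ _ P setT (1 ^+ 2)%R).
  have := integrable_prod_sqr (mW j) m1 (iW2 j) i1.
  by apply: eq_integrable => // w _ /=; rewrite mulr1.
have -> : \int[P]_w ((\sum_(j < n) W j w) ^+ 2)%:E =
    \int[P]_w \sum_(j < n) \sum_(k < n) (W j w * W k w)%:E.
  apply: eq_integral => w _.
  by rewrite expr2 big_distrlr/= -sumEFin; apply: eq_bigr => j _; rewrite sumEFin.
rewrite integral_sum//; last by move=> j; apply: integrable_sum => // k _; exact: (iWW j k).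
have -> : (n%:R * v)%:E = \sum_(j < n) v%:E.
  by rewrite sumEFin sumr_const card_ord mulr_natl.
apply: lee_sum => j _; rewrite integral_sum//; last by move=> k; exact: (iWW j k).
rewrite (bigD1 j)//= big1 ?adde0 => [|k kj].
  by under eq_integral do rewrite -expr2.
by rewrite indep_integralM// ?W0 ?mule0// => A B; apply: indep; rewrite eq_sym.
Qed.

(** The factor [q] makes the bound uniform in [q]. If [q <= 2 * delta] it is immediate. Otherwise
    the event forces the centred sum to deviate by at least [n q / 2], while its second moment is at
    most [2 n q]; Chebyshev leaves [8 / n]. *)
Lemma binomial_lower_tail {d' : measure_display} {S : measurableType d'}
    (P : probability Om R) n (Z : 'I_n -> Om -> S) (A : set S) (q delta : R) :
  (0 < n)%N -> (0 <= delta)%R -> measurable A ->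
  (forall j, measurable_fun setT (Z j)) -> pairwise_indep P Z ->
  (forall j, P (Z j @^-1` A) = q%:E) ->
  q%:E * P [set w | (n%:R^-1 * \sum_(j < n) \1_A (Z j w) <= delta)%R] <=
    (8 / n%:R + 2 * delta)%:E.
Proof.
move=> n0 d0 mA mZ indep PA.
have n0' : (0 < n%:R :> R)%R by rewrite ltr0n.
have q0 : (0 <= q)%R by rewrite -lee_fin -(PA (Ordinal n0)).
have q1 : (q <= 1)%R.
  rewrite -lee_fin -(PA (Ordinal n0)) probability_le1//.
  by rewrite -[_ @^-1` _]setTI; exact: mZ.
set E := [set w | _].
have m1 j : measurable_fun setT (fun w => \1_A (Z j w) : R).
  exact: measurableT_comp (mZ j).
have mE : measurable E.
  rewrite -[E]setTI; apply: measurable_fun_le => //.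
  by apply: measurable_funM => //; exact: measurable_sum.
have PE1 : P E <= 1 by exact: probability_le1.
have PEf : P E \is a fin_num by exact: fin_num_measure.
have [qd|qd] := leP q (2 * delta)%R.
  apply: (@le_trans _ _ q%:E).
    by rewrite -[leRHS]mule1 lee_wpmul2l.
  by rewrite lee_fin (le_trans qd)// lerDr divr_ge0.
have {}q0 : (0 < q)%R by apply: le_lt_trans qd; rewrite mulr_ge0.
pose F (x : S) : R := (\1_A x - q)%R.
have mF : measurable_fun setT F by exact: measurable_funB.
have mW j : measurable_fun setT (F \o Z j) by exact: measurableT_comp.
have mAj j : measurable (Z j @^-1` A) by rewrite -[_ @^-1` _]setTI; exact: mZ.
have indE j w : (\1_A (Z j w) = \1_(Z j @^-1` A) w :> R)%R.
  by rewrite !indicE; congr (_%:R); apply/idP/idP => /set_mem ?; apply/mem_set.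
have iA j : P.-integrable setT (fun w => (\1_A (Z j w))%:E).
  by under eq_fun do rewrite indE; exact: integrable_indic.
have A1 j : \int[P]_w (\1_A (Z j w))%:E = q%:E.
  under eq_integral do rewrite indE.
  by rewrite integral_indic// setIT; exact: PA.
have : \int[P]_w ((\sum_(j < n) (F \o Z j) w) ^+ 2)%:E <= (n%:R * (2 * q))%:E.
  apply: second_moment_sum => // [j|j|]; last exact: pairwise_indep_comp.
  (* Pointwise [(1_A - q)^2 <= 1_A + q^2], whose mean [q + q^2] is at most [2 q] because
     [q <= 1]. *)
  - apply: (@le_trans _ _ (\int[P]_w ((\1_A (Z j w))%:E + (q ^+ 2)%:E))).
      apply: ge0_le_integral => //.
      + by move=> w _; rewrite lee_fin sqr_ge0.
      + by apply/measurable_EFinP; exact: measurable_funX.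
      + by apply/measurable_EFinP; exact: measurable_funD.
      + move=> w _; rewrite -EFinD lee_fin /= /F indicE.
        by case: (_ \in _) => /=; nra.
    rewrite ge0_integralD//; [|exact/measurable_EFinP|by rewrite lee_fin sqr_ge0].
    rewrite A1 integral_cst//= probability_setT mule1 -EFinD lee_fin; nra.
  - under eq_integral do rewrite /= /F EFinB.
    rewrite integralB_EFin//; [|exact: iA|exact: finite_measure_integrable_cst].
    by rewrite A1 integral_cst//= probability_setT mule1 subee.
set s := fun w => (\sum_(j < n) (F \o Z j) w)%R => H.
(* On [E] the centred sum is at most [n (delta - q)], which lies below [- n q / 2] since
   [2 delta < q]. *)
have : ((n%:R * q / 2) ^+ 2)%:E * P E <= (n%:R * (2 * q))%:E.
  apply: le_trans H.
  have -> : P E = \int[P]_w (\1_E w)%:E by rewrite integral_indic// setIT.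
  rewrite -ge0_integralZl//; [|exact/measurable_EFinP|by rewrite lee_fin sqr_ge0].
  apply: ge0_le_integral => //.
  - by move=> w _; rewrite mule_ge0// lee_fin ?sqr_ge0.
  - by apply/measurable_EFinP; exact: measurable_funM.
  - by apply/measurable_EFinP; apply: measurable_funX; exact: measurable_sum.
  - move=> w _; rewrite -EFinM lee_fin indicE.
    have [/set_mem/= Hw|_] := boolP (w \in E); last by rewrite mulr0 sqr_ge0.
    have -> : (\sum_(j < n) (F \o Z j) w = \sum_(j < n) \1_A (Z j w) - n%:R * q)%R.
      by rewrite /F /= sumrB sumr_const card_ord mulr_natl.
    rewrite mulr1 -[leRHS]sqrrN opprB.
    have {Hw} : (\sum_(j < n) \1_A (Z j w) <= delta * n%:R)%R.
      by rewrite -ler_pdivrMr// mulrC.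
    move: (\sum_(j < n) _)%R => S0 HS.
    have nq : (0 <= n%:R * (q - 2 * delta))%R by rewrite mulr_ge0// subr_ge0 ltW.
    have nq0 : (0 <= n%:R * q)%R by rewrite mulr_ge0// ltW.
    by rewrite ler_sqr ?nnegrE; lra.
have -> : P E = (fine (P E))%:E by rewrite fineK.
rewrite -!EFinM !lee_fin.
set p := fine _ => Hp.
have H8 : (q * p <= 8 / n%:R)%R.
  rewrite ler_pdivlMr// -(ler_pM2l (mulr_gt0 n0' q0)).
  lra.
by rewrite (le_trans H8)// lerDl mulr_ge0.
Qed.

Lemma iid_pairs_pairwise {T : pmetricType R} (P : probability Om R) n
    (Z : 'I_n -> Om -> (borel T * R)%type) :
  iid_pairs P n Z -> pairwise_indep P Z.
Proof.
move=> [H _] j k jk A B mA mB.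
(* The remaining coordinates are left free: the whole space contributes a factor 1. *)
pose D i := if i == j then A else if i == k then B else setT.
have mD i : measurable (D i) by rewrite /D; case: ifP => // _; case: ifP.
have -> : Z j @^-1` A `&` Z k @^-1` B =
    \bigcap_(i in [set: 'I_n]) (Z i @^-1` D i).
  apply/seteqP; split=> w /=.
    move=> [ZA ZB] i _; rewrite /D /=.
    by case: eqP => [->//|_]; case: eqP => [->|].
  move=> Dw; split; first by have := Dw j I; rewrite /= /D eqxx.
  by have := Dw k I; rewrite /= /D eqxx eq_sym (negbTE jk).
rewrite H// (bigD1 j)//= (bigD1 k)/= ?[k == j]eq_sym//.
rewrite big1 ?mule1; last first.
  move=> i /andP[ij ik]; rewrite /D (negbTE ij) (negbTE ik).
  by rewrite preimage_setT probability_setT.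
by rewrite {1}/D eqxx /D eqxx eq_sym (negbTE jk).
Qed.

End Integration.

(** * Pointwise error of the estimator for a fixed sample *)

Section Estimator.
Set Implicit Arguments. Unset Strict Implicit.
Context {R : realType} {T : pmetricType R}.

Definition mball (x : T) (r : R) : set (borel T) := [set y | mdist x y < r].

Lemma measurable_mball (x : T) (r : R) : measurable (mball x r).
Proof.
apply: sub_sigma_algebra; rewrite openE => y /= xy; apply/nbhs_ballP.
exists (r - mdist x y) => /=; first by rewrite subr_gt0.
move=> z; rewrite ballEmdist /= ltrBrDl => yz.
exact: le_lt_trans (metric_triangle _ _ _) yz.
Qed.

Lemma KboxE (x y : T) (h : R) : 0 < h ->
  Kbox (mdist x y / h) = \1_(mball x h) (y : borel T).
Proof.
move=> h0; rewrite /Kbox divr_ge0 ?mdist_ge0 ?ltW//= ltr_pdivrMr// mul1r indicE.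
case: ifPn => xy; first by rewrite mem_set.
by rewrite memNset//=; exact/negP.
Qed.

(** The three terms are bias, noise and fallback. Where [estB] is at most [delta] the estimator is 0
    and the error is [g(x)^2 <= C^2]; elsewhere the error splits as [u / B + v / B], with [u]
    averaging increments of [g] and [v] the noise. *)
Lemma ghat_error (Y : set (borel T)) (C beta : R) (g : borel T -> R) n
    (h delta : R) (Xs : 'I_n -> T) (es : 'I_n -> R) (x : T) :
  holder_class Y beta C g -> 0 <= C -> 0 <= beta -> 0 < h -> 0 < delta ->
  Y x -> (forall j, Y (Xs j)) ->
  (ghat n h delta Xs (fun j => g (Xs j) + es j) x - g x) ^+ 2 <=
    2 * (C * h `^ beta) ^+ 2 +
    2 * (delta^-1 * n%:R^-1) ^+ 2 *
      (\sum_(j < n) es j * \1_(mball x h) (Xs j : borel T)) ^+ 2 +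
    C ^+ 2 * \1_[set Xs | estB n h Xs x <= delta] Xs.
Proof.
move=> [_ [gC gH]] C0 b0 h0 d0 Yx YX; rewrite indicE /ghat.
case: ltP => [dB|Bd]; last first.
  rewrite mem_set// mulr1 sub0r sqrrN -[leLHS]real_normK ?num_real//.
  have gC2 : `|g x| ^+ 2 <= C ^+ 2 by rewrite lerXn2r// ?nnegrE// gC.
  rewrite (le_trans gC2)// lerDr.
  by do ![exact: sqr_ge0 | apply: addr_ge0 | apply: mulr_ge0].
rewrite memNset/=; last by apply/negP; rewrite -ltNge.
rewrite mulr0 addr0.
set B := estB n h Xs x in dB *.
have B0 : 0 < B by exact: lt_trans dB.
pose K j : R := \1_(mball x h) (Xs j : borel T).
have BE : B = n%:R^-1 * \sum_(j < n) K j.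
  by rewrite /B /estB; congr (_ * _); apply: eq_bigr => j _; rewrite KboxE.
pose u := n%:R^-1 * \sum_(j < n) (g (Xs j) - g x) * K j.
pose v := n%:R^-1 * \sum_(j < n) es j * K j.
have AE : estA n h Xs (fun j => g (Xs j) + es j) x = u + v + g x * B.
  rewrite BE mulrCA -!mulrDr; congr (_ * _).
  rewrite mulr_sumr -!big_split/=; apply: eq_bigr => j _.
  by rewrite KboxE// -/(K j); ring.
have -> : estA n h Xs (fun j => g (Xs j) + es j) x / B - g x = u / B + v / B.
  by rewrite AE; field; rewrite gt_eqF.
(* Only sample points within [h] of [x] carry weight, so this is a weighted average of increments of
   [g] over distances below [h]. *)
have uB : `|u / B| <= C * h `^ beta.
  rewrite normrM normfV (gtr0_norm B0) ler_pdivrMr// BE mulrCA /u normrM.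
  rewrite ger0_norm ?invr_ge0// ler_wpM2l ?invr_ge0//.
  rewrite mulr_sumr (le_trans (ler_norm_sum _ _ _))// ler_sum// => j _.
  rewrite normrM (ger0_norm (_ : 0 <= K j))//.
  rewrite /K indicE; case: (boolP (_ \in _)) => [/set_mem/= xX|_]; last by rewrite !mulr0.
  rewrite !mulr1 (le_trans (gH _ _ (YX j) Yx))// ler_wpM2l//.
  by rewrite ge0_ler_powR// ?nnegrE ?mdist_ge0 ?ltW// metric_sym.
have vB : `|v / B| <= delta^-1 * n%:R^-1 * `|\sum_(j < n) es j * K j|.
  rewrite normrM normfV (gtr0_norm B0) /v normrM ger0_norm ?invr_ge0//.
  rewrite mulrC mulrA ler_wpM2r// ler_wpM2r ?invr_ge0//.
  by rewrite lef_pV2 ?posrE// ltW.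
move: uB vB; rewrite -/K; set s := \sum_(j < n) _.
set u' := u / B; set v' := v / B; set c := C * _; set e := delta^-1 * _ => uB vB.
have u2 : u' ^+ 2 <= c ^+ 2.
  by rewrite -[leLHS]real_normK ?num_real// lerXn2r// nnegrE (le_trans _ uB).
have v2 : v' ^+ 2 <= e ^+ 2 * s ^+ 2.
  rewrite -[leLHS]real_normK ?num_real// -[s ^+ 2]real_normK ?num_real//.
  by rewrite -exprMn lerXn2r// nnegrE (le_trans _ vB).
(* This gives [(u' + v')^2 <= 2 u'^2 + 2 v'^2], the source of both factors 2. *)
have := sqr_ge0 (u' - v'); rewrite -mulrA; nra.
Qed.

End Estimator.

(** * From the pointwise error to the integrated risk *)

Section Risk.
Set Implicit Arguments. Unset Strict Implicit.
Context {R : realType} {T : pmetricType R}.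
Context {d : measure_display} {Om : measurableType d}.
Context (P : probability Om R) (PX : probability (borel T) R) (n : nat).
Context (X : 'I_n -> Om -> borel T) (eps : 'I_n -> Om -> R).
Context (Y : set (borel T)) (C beta cv : R) (g : borel T -> R).
Hypothesis n0 : (0 < n)%N.
Hypothesis mX : forall j, measurable_fun setT (X j).
Hypothesis meps : forall j, measurable_fun setT (eps j).
Hypothesis iid : iid_pairs P n (fun j w => (X j w, eps j w)).
Hypothesis law : forall j (A : set (borel T)), measurable A ->
  P (X j @^-1` A) = PX A.
Hypothesis mean0 : forall j, cond_mean_zero P (X j) (eps j).
Hypothesis varle : forall j, cond_var_le P (X j) (eps j) cv.
Hypothesis mY : measurable Y.
Hypothesis PXY : PX Y = 1%E.
Hypothesis gH : holder_class Y beta C g.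
Hypothesis C0 : 0 <= C.
Hypothesis beta0 : 0 <= beta.
Context (h delta : R).
Hypothesis h0 : 0 < h.
Hypothesis delta0 : 0 < delta.

Lemma PXYC : PX (~` Y) = 0%E.
Proof. by rewrite probability_setC// PXY subee. Qed.

Lemma design_ae : {ae P, forall w j, Y (X j w)}.
Proof.
suff H j : {ae P, forall w, Y (X j w)} by exact: filter_forall.
exists (X j @^-1` (~` Y)); split; last by move=> w /=.
  by rewrite -[_ @^-1` _]setTI; apply: mX => //; exact: measurableC.
by rewrite -PXYC; apply: law; exact: measurableC.
Qed.

Lemma cv_ge0 : 0 <= cv.
Proof.
have := varle (Ordinal n0) measurableT.
rewrite preimage_setT probability_setT mule1 -lee_fin; apply: le_trans.
by apply: integral_ge0 => w _; rewrite lee_fin sqr_ge0.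
Qed.

Lemma measurable_indic_mball x :
  measurable_fun setT (\1_(mball x h) : borel T -> R).
Proof. by apply: measurable_indic; exact: measurable_mball. Qed.

(** The conditional moment assumptions are integrals over preimages under [X j]. Multiplying [eps j]
    by the ball indicator restricts to such a preimage, so each summand is centred with second
    moment at most [cv]. *)
Lemma noise_second_moment x :
  (\int[P]_w ((\sum_(j < n) eps j w * \1_(mball x h) (X j w)) ^+ 2)%:E <=
   (n%:R * cv)%:E)%E.
Proof.
pose D j : set Om := X j @^-1` mball x h.
have restr (k : R -> R) j w : k 0 = 0 ->
    (k (eps j w * \1_(mball x h) (X j w)))%:E = ((fun w => (k (eps j w))%:E) \_ (D j)) w.
  move=> k0; rewrite patchE indicE.
  have -> : (w \in D j) = (X j w \in mball x h).
    by apply/idP/idP => /set_mem ?; apply/mem_set.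
  by case: (_ \in _); rewrite ?mulr1// mulr0 k0.
pose F (z : borel T * R) : R := z.2 * \1_(mball x h) z.1.
have mF : measurable_fun setT F.
  apply: measurable_funM => //.
  exact: measurableT_comp (measurable_indic_mball x) _.
apply: (@second_moment_sum _ _ _ P n (fun j w => eps j w * \1_(mball x h) (X j w)) cv).
- move=> j; exact: measurableT_comp mF (measurable_fun_pair (mX j) (meps j)).
- move=> j; under eq_integral do rewrite (restr (fun u => u ^+ 2)) ?expr0n//.
  rewrite -integral_mkcond (le_trans (varle j (measurable_mball x h)))//.
  rewrite -[leRHS]mule1 lee_wpmul2l ?lee_fin ?cv_ge0//.
  by rewrite law ?probability_le1//; exact: measurable_mball.
- move=> j; under eq_integral do rewrite (restr id)//.
  by rewrite -integral_mkcond; apply: (mean0 j).2; exact: measurable_mball.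
- exact: (pairwise_indep_comp mF (iid_pairs_pairwise iid)).
Qed.

Lemma measurable_estB_le x :
  measurable [set w | estB n h (fun j => X j w) x <= delta].
Proof.
rewrite -[X in measurable X]setTI; apply: measurable_fun_le => //.
apply: measurable_funM => //; apply: measurable_sum => j.
under eq_fun do rewrite KboxE//.
exact: measurableT_comp (measurable_indic_mball x) (mX j).
Qed.

Lemma pointwise_risk x : Y x ->
  (\int[P]_w ((ghat n h delta (fun j => X j w) (fun j => g (X j w) + eps j w) x
        - g x) ^+ 2)%:E <=
   (2 * (C * h `^ beta) ^+ 2 + 2 * cv / (n%:R * delta ^+ 2))%:E +
   (C ^+ 2)%:E * P [set w | (estB n h (fun j => X j w) x <= delta)%R])%E.
Proof.
move=> Yx; set E := [set w | _].
have mE : measurable E by exact: measurable_estB_le.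
pose s w := \sum_(j < n) eps j w * \1_(mball x h) (X j w).
have ms : measurable_fun setT s.
  apply: measurable_sum => j; apply: measurable_funM => //.
  exact: measurableT_comp (measurable_indic_mball x) (mX j).
pose a := 2 * (C * h `^ beta) ^+ 2; pose b := 2 * (delta^-1 * n%:R^-1) ^+ 2.
have a0 : 0 <= a by rewrite mulr_ge0// sqr_ge0.
have b0 : 0 <= b by rewrite mulr_ge0// sqr_ge0.
pose maj w := (a%:E + b%:E * (s w ^+ 2)%:E + (C ^+ 2)%:E * (\1_E w)%:E)%E.
apply: (@le_trans _ _ (\int[P]_w maj w)%E).
  apply: le_integral_nonmeas.
  - by move=> w; rewrite lee_fin sqr_ge0.
  - move=> w; rewrite /maj -!EFinM -!EFinD lee_fin.
    by do ![exact: sqr_ge0 | exact: a0 | exact: b0 | done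
           | apply: addr_ge0 | apply: mulr_ge0].
  - apply/measurable_EFinP;
      do ![apply: measurable_funD | apply: measurable_funM
          | apply: measurable_funX | done].
  (* The design points lie in [Y] only almost surely, so the error bound holds off a null set. *)
  - have := design_ae; apply: filterS => w YX.
    rewrite /maj -!EFinM -!EFinD lee_fin.
    have := ghat_error (fun j => eps j w) gH C0 beta0 h0 delta0 Yx YX.
    rewrite !indicE.
    have -> // : (w \in E) =
        ((fun j => X j w) \in [set Xs | estB n h Xs x <= delta]).
      by apply/idP/idP => /set_mem ?; apply/mem_set.
rewrite /maj ge0_integralD//=; last 4 first.
- move=> w _; rewrite -!EFinM -!EFinD lee_fin.
  by do ![exact: sqr_ge0 | exact: a0 | exact: b0 | done
         | apply: addr_ge0 | apply: mulr_ge0].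
- by apply/measurable_EFinP;
    do ![apply: measurable_funD | apply: measurable_funM
        | apply: measurable_funX | done].
- by move=> w _; rewrite -EFinM lee_fin mulr_ge0// sqr_ge0.
- by apply/measurable_EFinP;
    do ![apply: measurable_funD | apply: measurable_funM
        | apply: measurable_funX | done].
rewrite ge0_integralD//=; last 2 first.
- by move=> w _; rewrite -EFinM lee_fin mulr_ge0 ?sqr_ge0.
- by apply/measurable_EFinP;
    do ![apply: measurable_funD | apply: measurable_funM
        | apply: measurable_funX | done].
rewrite integral_cst//= probability_setT mule1.
have -> : (\int[P]_w ((C ^+ 2)%:E * (\1_E w)%:E) = (C ^+ 2)%:E * P E)%E.
  rewrite ge0_integralZl//; [|exact/measurable_EFinP|by rewrite lee_fin sqr_ge0].
  by rewrite integral_indic// setIT.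
rewrite leeD2r// EFinD leeD2l// ge0_integralZl//; last 2 first.
- by apply/measurable_EFinP; exact: measurable_funX.
- by move=> w _; rewrite lee_fin sqr_ge0.
rewrite (le_trans (lee_wpmul2l _ (noise_second_moment x)))// -EFinM lee_fin /b.
rewrite le_eqVlt; apply/orP; left; apply/eqP; field.
by rewrite pnatr_eq0 -lt0n n0 gt_eqF.
Qed.

Lemma risk_bound N (c : 'I_N -> T) :
  (forall y, Y y -> exists i, mdist (c i) y < h / 2) ->
  (risk P PX n h delta X eps g <=
   (2 * (C * h `^ beta) ^+ 2 + 2 * cv / (n%:R * delta ^+ 2) +
    C ^+ 2 * (N%:R * (8 / n%:R + 2 * delta)))%:E)%E.
Proof.
move=> cover; set a := 2 * _ ^+ 2 + _.
have a0 : 0 <= a.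
  apply: addr_ge0; first by rewrite mulr_ge0 ?sqr_ge0.
  by rewrite divr_ge0 ?mulr_ge0 ?sqr_ge0 ?cv_ge0 ?(ltW delta0).
have mI1 (A : set (borel T)) : measurable A ->
    measurable_fun setT (\1_A : borel T -> R) by exact: measurable_indic.
pose S i := mball (c i) (h / 2).
have mS i : measurable (S i) by exact: measurable_mball.
pose E i := [set w | n%:R^-1 * \sum_(j < n) \1_(S i) (X j w) <= delta].
have mE i : measurable (E i).
  rewrite -[E i]setTI; apply: measurable_fun_le => //.
  apply: measurable_funM => //; apply: measurable_sum => j.
  exact: measurableT_comp (mI1 _ (mS i)) (mX j).
pose p i := fine (P (E i)).
have pE i : P (E i) = (p i)%:E by rewrite /p fineK//; exact: fin_num_measure.
have p0 i : 0 <= p i by rewrite -lee_fin -pE.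
have mI i : measurable_fun setT (fun x : borel T => ((C ^+ 2 * p i)%:E * (\1_(S i) x)%:E)%E).
  by apply/measurable_EFinP; apply: measurable_funM => //; exact: mI1.
have I0 i (x : borel T) : (0 <= (C ^+ 2 * p i)%:E * (\1_(S i) x)%:E)%E.
  by rewrite -EFinM lee_fin !mulr_ge0// ?sqr_ge0.
pose maj (x : borel T) := (a%:E + \sum_(i < N) (C ^+ 2 * p i)%:E * (\1_(S i) x)%:E)%E.
(* The inner expectation need not be measurable in [x]; the majorant, which
   depends on [x] only through the balls containing it, is. *)
apply: (@le_trans _ _ (\int[PX]_x maj x)%E).
  apply: le_integral_nonmeas.
  - by move=> x; apply: integral_ge0 => w _; rewrite lee_fin sqr_ge0.
  - by move=> x; rewrite adde_ge0 ?lee_fin// sume_ge0.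
  - by apply: emeasurable_funD => //; exact: emeasurable_sum.
  exists (~` Y); split; [exact: measurableC|exact: PXYC|].
  apply: subsetC => x Yx /=.
  apply: (le_trans (pointwise_risk Yx)); rewrite leeD2l//.
  (* Keep the summand of one ball [S i] containing [x]; the others are nonnegative. *)
  have [i ci] := cover _ Yx.
  rewrite (bigD1 i)//= indicE mem_set// mule1 -[leLHS]adde0 leeD ?sume_ge0//.
  rewrite (EFinM (C ^+ 2) (p i)) lee_wpmul2l ?lee_fin ?sqr_ge0// -pE le_measure ?inE//.
    exact: measurable_estB_le.
  move=> w /= ; apply: le_trans; rewrite ler_wpM2l ?invr_ge0// ler_sum// => j _.
  rewrite KboxE// !indicE ler_nat.
  have [/set_mem/= Sw|//] := boolP (X j w \in S i).
  rewrite mem_set//= /mball/= (le_lt_trans (metric_triangle x (c i) _))//.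
  by rewrite metric_sym [ltRHS]splitr ltrD.
rewrite /maj ge0_integralD//=; last 2 first.
- by move=> x _; rewrite sume_ge0.
- exact: emeasurable_sum.
rewrite integral_cst//= probability_setT mule1 (EFinD a) leeD2l// ge0_integral_sum//.
have -> : C ^+ 2 * (N%:R * (8 / n%:R + 2 * delta)) =
    \sum_(i < N) (C ^+ 2 * (8 / n%:R + 2 * delta)).
  by rewrite sumr_const card_ord -[RHS]mulr_natl mulrCA.
rewrite -sumEFin; apply: lee_sum => i _.
rewrite ge0_integralZl//=; last 2 first.
- by apply/measurable_EFinP; exact: mI1.
- by rewrite lee_fin mulr_ge0 ?sqr_ge0.
(* Integrating over [x] turns the indicator of [S i] into its mass, exactly the factor [q] of
   [binomial_lower_tail]. *)
rewrite integral_indic// setIT.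
have qE : PX (S i) = (fine (PX (S i)))%:E by rewrite fineK//; exact: fin_num_measure.
rewrite (EFinM (C ^+ 2) (p i)) (EFinM (C ^+ 2) (8 / _ + _)) -muleA lee_wpmul2l ?lee_fin ?sqr_ge0//.
have mF : measurable_fun setT (fst : borel T * R -> borel T) by exact: measurable_fst.
have iX : pairwise_indep P X := pairwise_indep_comp mF (iid_pairs_pairwise iid).
have qX j : P (X j @^-1` S i) = (fine (PX (S i)))%:E by rewrite -qE; exact: law.
have := binomial_lower_tail n0 (ltW delta0) (mS i) mX iX qX.
by rewrite -qE -/(E i) pE muleC.
Qed.

End Risk.

(** * Powers of [n] against powers of [ln n], and the bandwidth *)

Section Rates.
Set Implicit Arguments. Unset Strict Implicit.
Context {R : realType}.

(** Apply [ln u < u] at [u = x^(a / b)] and raise to the power [b]. This absorbs polynomially small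
    terms into the logarithmic rate. *)
Lemma powRN_le_ln (x a b : R) : 1 < x -> 0 < a -> 0 < b ->
  x `^ (- a) <= (b / a) `^ b * ln x `^ (- b).
Proof.
move=> x1 a0 b0; have x0 : 0 < x := lt_trans ltr01 x1.
have lx : 0 < ln x by rewrite ln_gt0.
have ba : 0 <= b / a by rewrite ltW ?divr_gt0.
have : ln x <= b / a * x `^ (a / b).
  have := ln_sublinear (powR_gt0 (a / b) x0); rewrite ln_powR => /ltW.
  by rewrite -ler_pdivlMl ?divr_gt0// invf_div.
move=> /(ge0_ler_powR (ltW b0)); rewrite !nnegrE ltW// mulr_ge0 ?powR_ge0// => /(_ isT isT).
rewrite powRM ?powR_ge0// -powRrM divfK ?gt_eqF// => H.
by rewrite !powRN ler_pdivlMr ?powR_gt0// mulrC ler_pdivrMr ?powR_gt0.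
Qed.

Lemma bandwidth_sqr (y gam beta : R) :
  ((y `^ (- gam^-1)) `^ beta) ^+ 2 = y `^ (- (2 * beta / gam)).
Proof.
rewrite -powR_mulrn ?powR_ge0// -!powRrM; congr (_ `^ _); ring.
Qed.

(** With [y = d ln n], this evaluates the entropy bound at the covering radius [h / 2]. *)
Lemma half_bandwidthN (y gam : R) : 0 < y -> 0 < gam ->
  (y `^ (- gam^-1) / 2) `^ (- gam) = 2 `^ gam * y.
Proof.
move=> y0 g0; rewrite powRM ?powR_ge0// -powRrM mulrNN mulVf ?gt_eqF//.
rewrite powRr1 ?ltW// mulrC; congr (_ * _).
by rewrite -powR_inv1// -powRrM mulrNN mul1r.
Qed.

Lemma bandwidth_lt (y gam s : R) : 0 < gam -> 0 < s -> s `^ (- gam) < y ->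
  y `^ (- gam^-1) < s.
Proof.
move=> g0 s0 sy; have y0 : 0 < y by rewrite (le_lt_trans (powR_ge0 _ _) sy).
rewrite powRN invf_plt ?posrE ?powR_gt0//.
have -> : s^-1 = (s `^ (- gam)) `^ (gam^-1).
  by rewrite -powRrM mulNr mulfV ?gt_eqF// powR_inv1// ltW.
by apply: gt0_ltr_powR; rewrite ?nnegrE ?invr_gt0 ?powR_ge0 ?ltW.
Qed.

(** Halving the bandwidth costs [2^gam], whereas [d] is bounded with [4^gam]; the spare factor
    [2^(-gam)] is below 1. *)
Lemma entropy_exponent_lt (eta d c1 gam : R) : 0 < c1 -> 0 < gam -> 0 < eta ->
  d < eta * c1^-1 * 4 `^ (- gam) ->
  c1 * (2 `^ gam * d) < eta.
Proof.
move=> c10 g0 eta0 hd.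
have t1 : 1 < 2 `^ gam :> R.
  rewrite -[ltLHS](_ : 1 `^ gam = 1); last by rewrite powR1.
  by apply: gt0_ltr_powR; rewrite ?nnegrE ?ltr1n.
have E4 : 4 `^ (- gam) = (2 `^ gam * 2 `^ gam)^-1 :> R.
  by rewrite powRN -powRM//; congr (_ `^ _)^-1; rewrite -natrM.
have t0 : 0 < 2 `^ gam :> R by exact: lt_trans t1.
rewrite E4 in hd; move: hd; set t := 2 `^ gam in t0 t1 *.
rewrite -(ltr_pM2l (mulr_gt0 c10 t0)) => hd; rewrite mulrA (lt_trans hd)//.
have -> : c1 * t * (eta * c1^-1 * (t * t)^-1) = eta * t^-1.
  by field; rewrite !gt_eqF.
by rewrite gtr_pMr// invf_lt1.
Qed.

Lemma nat_le_powR (N : nat) (x k : R) : 0 < x -> ln N%:R <= k * ln x ->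
  N%:R <= x `^ k.
Proof.
(* The value of [ln] at 0 is a convention, so [N = 0] is settled by nonnegativity of the power. *)
move=> x0; case: N => [|N] H; first by rewrite powR_ge0.
by rewrite -ler_ln ?posrE ?powR_gt0// ln_powR.
Qed.

End Rates.

(** * Assembling the logarithmic rate *)

Theorem theorem1 (R : realType) (T : pmetricType R)
  (hpolish : @polish R T)
  (Y : set (borel T)) (hY : measurable Y)
  (s0 c0 c1 gam : R) (hs0 : 0 < s0) (hc0 : 0 < c0) (hc01 : c0 < c1)
  (hgam : 0 < gam) (hentropy : entropy_condition Y s0 c0 c1 gam)
  (C beta : R) (hC : 0 < C) (hbeta : 0 < beta <= 1)
  (eta d cv : R) (heta : 0 < eta < 2^-1)
  (hd : 0 < d < eta * c1^-1 * 4 `^ (- gam))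
  (dO : nat -> measure_display) (Om : forall n : nat, measurableType (dO n))
  (P : forall n : nat, probability (Om n) R)
  (PX : forall n : nat, probability (borel T) R)
  (X : forall n : nat, 'I_n -> Om n -> borel T)
  (eps : forall n : nat, 'I_n -> Om n -> R)
  (hPXY : forall n, PX n Y = 1%E)
  (hXmeas : forall n (j : 'I_n), measurable_fun [set: Om n] (X n j))
  (hemeas : forall n (j : 'I_n), measurable_fun [set: Om n] (eps n j))
  (hlaw : forall n (j : 'I_n) (A : set (borel T)), measurable A ->
            P n (X n j @^-1` A) = PX n A)
  (hiid : forall n, iid_pairs (P n) n (fun j w => (X n j w, eps n j w)))
  (hmean : forall n (j : 'I_n), cond_mean_zero (P n) (X n j) (eps n j))
  (hvar : forall n (j : 'I_n), cond_var_le (P n) (X n j) (eps n j) cv) :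
  exists M : R, exists N : nat, forall n : nat, (N <= n)%N ->
    (ereal_sup [set risk (P n) (PX n) n
                      ((d * ln n%:R) `^ (- gam^-1))   (* h *)
                      (n%:R `^ (- eta))               (* delta_n *)
                      (X n) (eps n) g
               | g in holder_class Y beta C]
     <= (M * (ln n%:R) `^ (- (2 * beta / gam)))%:E)%E.
Proof.
have c10 : 0 < c1 by exact: lt_trans hc01.
case/andP: hbeta => beta0 beta1; case/andP: heta => eta0 eta2.
case/andP: hd => d0 hd1.
set k := c1 * (2 `^ gam * d).
have keta : k < eta by exact: entropy_exponent_lt hd1.
pose b := 2 * beta / gam.
have b0 : 0 < b by rewrite divr_gt0// mulr_gt0.
(* Decay exponents: up to constants, the noise term is [n^(-a2)] and the covering term at most
   [n^(-a3)]. They are positive by [eta < 1 / 2] and [k < eta]. *)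
pose a2 := 1 - 2 * eta; have a20 : 0 < a2 by rewrite /a2; lra.
pose a3 := eta - k; have a30 : 0 < a3 by rewrite subr_gt0.
(* The summands are the constants of [T1] (bias), [T2] (noise) and [T3] (small empirical mass). *)
exists (2 * C ^+ 2 * d `^ (- b) + 2 * cv * (b / a2) `^ b + 10 * C ^+ 2 * (b / a3) `^ b).
(* Once [d ln n] exceeds [K], [h < 2 s0], so the radius [h / 2] is admissible in the entropy
   condition; [n >= 2] keeps [ln n] positive. *)
pose K := (2 * s0) `^ (- gam).
exists (maxn 2 (Num.bound (expR (K / d)))) => n; rewrite geq_max => /andP[n2 nK].
set L := ln n%:R.
have n1 : 1 < n%:R :> R by rewrite ltr1n.
have n0 : 0 < n%:R :> R := lt_trans ltr01 n1.
have L0 : 0 < L by rewrite ln_gt0.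
have KL : K < d * L.
  rewrite mulrC -ltr_pdivrMr// -ltr_expR lnK ?posrE//.
  by rewrite (lt_le_trans (archi_boundP (expR_ge0 _)))// ler_nat.
set h := (d * L) `^ (- gam^-1); set delta := n%:R `^ (- eta).
have dL0 : 0 < d * L by rewrite mulr_gt0.
have h0 : 0 < h by exact: powR_gt0.
have delta0 : 0 < delta by exact: powR_gt0.
have hs : 0 < h / 2 < s0.
  by rewrite divr_gt0//= ltr_pdivrMr// mulrC bandwidth_lt// mulr_gt0.
have [N [[[c cov] _] /andP[_ lnN]]] := hentropy _ hs.
have NE : N%:R <= n%:R `^ k :> R.
  apply: nat_le_powR => //; apply: (le_trans lnN).
  by rewrite half_bandwidthN// /k -!mulrA.
have n_gt0 : (0 < n)%N by exact: ltn_trans n2.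
have cv0 : 0 <= cv := cv_ge0 n_gt0 (hvar n).
apply: ge_ereal_sup => _ [g hg <-].
apply: (le_trans (risk_bound n_gt0 (hXmeas n) (hemeas n) (hiid n) (hlaw n)
  (hmean n) (hvar n) hY (hPXY n) hg (ltW hC) (ltW beta0) h0 delta0 cov)).
rewrite lee_fin -/b.
have T1 : 2 * (C * h `^ beta) ^+ 2 = 2 * C ^+ 2 * d `^ (- b) * L `^ (- b).
  by rewrite exprMn bandwidth_sqr powRM ?ltW// !mulrA.
have T2 : 2 * cv / (n%:R * delta ^+ 2) <= 2 * cv * (b / a2) `^ b * L `^ (- b).
  rewrite -[leRHS]mulrA ler_wpM2l ?mulr_ge0//.
  have -> : (n%:R * delta ^+ 2)^-1 = n%:R `^ (- a2).
    rewrite powRN -powR_mulrn ?powR_ge0// -powRrM -[X in X * _]powRr1 ?ltW//.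
    rewrite -powRD ?(gt_eqF n0) ?implybT//; congr (_ `^ _)^-1; rewrite /a2; ring.
  exact: powRN_le_ln.
have T3 : C ^+ 2 * (N%:R * (8 / n%:R + 2 * delta)) <=
    10 * C ^+ 2 * (b / a3) `^ b * L `^ (- b).
  have -> : 10 * C ^+ 2 * (b / a3) `^ b * L `^ (- b) =
    C ^+ 2 * (10 * ((b / a3) `^ b * L `^ (- b))) by ring.
  rewrite ler_wpM2l ?sqr_ge0//.
  (* Since [eta < 1], [8 / n + 2 delta] is at most [10 delta], whence the constant 10. *)
  have nd : n%:R^-1 <= delta.
    rewrite -powR_inv1 ?(ltW n0)//; apply: ler_powR; [exact: ltW|lra].
  apply: (@le_trans _ _ (10 * n%:R `^ (- a3))).
    have -> : n%:R `^ (- a3) = n%:R `^ k * delta.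
      rewrite /delta -powRD ?(gt_eqF n0) ?implybT//; congr (_ `^ _); rewrite /a3; ring.
    rewrite mulrCA ler_pM// ?addr_ge0 ?mulr_ge0 ?invr_ge0 ?(ltW delta0)//.
    lra.
  by rewrite ler_wpM2l// powRN_le_ln.
by rewrite T1 [leRHS]mulrDl [X in _ <= X + _]mulrDl lerD// lerD.
Qed.
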